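(* Let $\epsilon_1,\dots,\epsilon_n\in\{*,0,1,2,\dots\}$ be such that $(L_q^{\epsilon_1},\dots,L_q^{\epsilon_n})$ is a lattice word. Then $K^q_n(L_q^{\epsilon_1},\dots,L_q^{\epsilon_n})=0$ unless $\epsilon_1=\dots=\epsilon_{n-1}=*$ and $\epsilon_n=n-1$. In the latter case $$K^q_n(L_q^*,\dots,L_q^*,L_q^{n-1})=\rho\big(L_q^*L_q^*\cdots L_q^*L_q^{n-1}\big)=[n-1]_q!.$$
   Context: Fix $q$ with $-1\le q\le 1$. Let $\mathcal H$ be a complex Hilbert space with orthonormal basis $(e_i)_{i\ge0}$. On the algebraic full Fock space $\mathbb C\Omega\oplus\bigoplus_{n\ge1}\mathcal H^{\otimes n}$ define $P^q_n(\eta_1\otimes\cdots\otimes\eta_n)=\sum_{\sigma\in\mathfrak S_n}q^{\mathrm{inv}(\sigma)}\eta_{\sigma^{-1}(1)}\otimes\cdots\otimes\eta_{\sigma^{-1}(n)}$ ($\mathrm{inv}$ = number of inversions) and $\langle\xi,\eta\rangle_q=\delta_{m,n}\langle\xi,P_n^q\eta\rangle$ for $\xi\in\mathcal H^{\otimes m},\eta\in\mathcal H^{\otimes n}$; the $q$-Fock space $\mathcal F_q(\mathcal H)$ is the completion (after dividing out null vectors). Creation operators $L_q(\xi)\Omega=\xi$, $L_q(\xi)\eta_1\otimes\cdots\otimes\eta_n=\xi\otimes\eta_1\otimes\cdots\otimes\eta_n$; annihilation operators $L_q^*(\xi)\Omega=0$, $L^*_q(\xi)\eta_1\otimes\cdots\otimes\eta_n=\sum_{k=1}^nq^{k-1}\langle\xi,\eta_k\rangle\eta_1\otimes\cdots\widehat{\eta_k}\cdots\otimes\eta_n$.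 The state is $\rho(X)=\langle\Omega,X\Omega\rangle_q$. Let $L_q=L_q(e_0)$; for $X$ in the $*$-algebra generated by $L_q$ and $k\ge1$, $X^{(k)}$ is obtained by replacing $L_q(e_0)$ by $L_q(e_k)$ (and $L_q^*(e_0)$ by $L_q^*(e_k)$). For $\pi\in\Pi_n$ (set partitions of $[n]$, viewed as maps to block numbers) $\rho_\pi(X_1,\dots,X_n)=\rho(X_1^{(\pi(1))}\cdots X_n^{(\pi(n))})$, $K^q_\pi=\sum_{\sigma\le\pi}\rho_\sigma\mu(\sigma,\pi)$ ($\mu$ Möbius function of refinement order), $K^q_n=K^q_{\hat1_n}$. Notation: $L_q^0=I$, $L_q^*$ the adjoint, $L_q^k$ the power; $[m]_q=1+q+\dots+q^{m-1}$, $[m]_q!=[1]_q\cdots[m]_q$. Counting $*$ as $-1$, $(L_q^{\epsilon_1},\dots,L_q^{\epsilon_n})$ is a lattice word if $y_j=\epsilon_{j+1}+\dots+\epsilon_n\ge0$ for all $j$ and $y_0=0$. *)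

(* Defs.v *)
From HB Require Import structures.
From mathcomp Require Import classical_sets reals topology normedtype.
From mathcomp Require Import all_boot all_order all_fingroup all_algebra finmap.
From mathcomp Require Import sesquilinear complex.
From mathcomp Require Import zify.
From mathcomp Require Import -(notations) monalg.

Set Implicit Arguments.
Unset Strict Implicit.
Unset Printing Implicit Defensive.

Import Order.TTheory GRing.Theory Num.Theory.
Import numFieldNormedType.Exports.
Local Open Scope ring_scope.

Section Moebius.
Context {disp : Order.disp_t} {T : finPOrderType disp}.

Fixpoint moebius_rec (fuel : nat) (x y : T) : int :=
  if fuel is m.+1 then
    if x == y then 1
    else - \sum_(z | (x <= z)%O && (z < y)%O) moebius_rec m x z
  else 0.

(* Strict chains in T have at most #|T| elements, so the fuel never runs out;
   see moebiusxx and moebius_sum. *)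
Definition moebius (x y : T) : int := moebius_rec #|T| x y.

Lemma moebius_rec_fuel m k (x y : T) :
  (#|[set z : T | (z <= y)%O]| <= m)%N -> (#|[set z : T | (z <= y)%O]| <= k)%N ->
  moebius_rec m x y = moebius_rec k x y.
Proof.
have card_gt0 (z : T) : (0 < #|[set t : T | (t <= z)%O]|)%N.
  by apply/card_gt0P; exists z; rewrite inE.
elim: m k y => [|m IHm] [|k] y; rewrite ?leqn0 ?(gtn_eqF (card_gt0 _)) //= => ym yk.
case: eqP => // _; congr (- _); apply: eq_bigr => z /andP[_ zy].
have ltc : (#|[set t : T | (t <= z)%O]| < #|[set t : T | (t <= y)%O]|)%N.
  apply/proper_card/properP; split.
    by apply/subsetP => t; rewrite !inE => /le_trans; apply; exact: ltW.
  by exists y; rewrite !inE ?lexx // (lt_geF zy).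
by apply: IHm; rewrite -ltnS; exact: leq_trans ltc _.
Qed.

Lemma moebiusxx (x : T) : moebius x x = 1.
Proof.
rewrite /moebius; case E: #|T| => [|m] /=; last by rewrite eqxx.
by have := card0_eq E x.
Qed.

Lemma moebius_sum (x y : T) : (x < y)%O ->
  \sum_(z | (x <= z <= y)%O) moebius x z = 0.
Proof.
move=> xy; rewrite (bigD1 y) /=; last by rewrite (ltW xy) lexx.
rewrite {1}/moebius; case E: #|T| => [|m]; first by have := card0_eq E x.
rewrite /= (lt_eqF xy) addrC; apply/eqP; rewrite subr_eq0; apply/eqP.
apply: eq_big => [z|z /andP[/andP[xz zy] zNy]]; first by rewrite lt_neqAle -andbA [X in _ && X]andbC.
have {zy zNy} zy : (z < y)%O by rewrite lt_neqAle zNy.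
apply: moebius_rec_fuel; first exact: max_card.
rewrite -ltnS -E; apply: leq_trans (max_card [set t : T | (t <= y)%O]).
apply/proper_card/properP; split.
  by apply/subsetP => t; rewrite !inE => /le_trans; apply; exact: ltW.
by exists y; rewrite !inE ?lexx // (lt_geF zy).
Qed.

End Moebius.

Definition setpart (n : nat) : Type :=
  {P : {set {set 'I_n}} | partition P [set: 'I_n]}.

HB.instance Definition _ n := Finite.on (setpart n).

Definition refines n (s p : setpart n) : bool :=
  [forall A in val s, exists B in val p, A \subset B].

Lemma refinesP n (s p : setpart n) :
  reflect (forall A, A \in val s -> exists2 B, B \in val p & A \subset B)
          (refines s p).
Proof.
apply: (iffP forall_inP) => sp A /sp; first by move=> /exists_inP[B]; exists B.
by move=> [B Bp AB]; apply/exists_inP; exists B.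
Qed.

Lemma refines_refl n : reflexive (@refines n).
Proof. by move=> s; apply/refinesP => A As; exists A. Qed.

Lemma refines_trans n : transitive (@refines n).
Proof.
move=> t s p /refinesP st /refinesP tp; apply/refinesP => A /st[B /tp[D Dp BD] AB].
by exists D => //; exact: subset_trans BD.
Qed.

Lemma refines_anti n : antisymmetric (@refines n).
Proof.
have sub (s p : setpart n) : refines s p -> refines p s -> val s \subset val p.
  move=> /refinesP sp /refinesP ps; apply/subsetP => A As.
  have [B Bp AB] := sp A As; have [D Ds BD] := ps B Bp.
  have /and3P[_ ts s0] := valP s.
  have [x xA] : exists x, x \in A.
    by apply/set0Pn; apply: contraNneq s0 => <-.
  have xD : x \in D by apply: (subsetP BD); exact: (subsetP AB).
  have AD : A = D by rewrite -(def_pblock ts As xA) (def_pblock ts Ds xD).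
  suff -> : A = B by [].
  by apply/eqP; rewrite eqEsubset AB AD.
by move=> s p /andP[sp ps]; apply/val_inj/eqP; rewrite eqEsubset !sub.
Qed.

Fact setpart_display : Order.disp_t. Proof. exact: Order.Disp tt tt. Qed.

HB.instance Definition _ n := Order.Le_isPOrder.Build setpart_display (setpart n)
  (@refines_refl n) (@refines_anti n) (@refines_trans n).

Lemma le_setpartE n (s p : setpart n) : (s <= p)%O = refines s p.
Proof. by []. Qed.

Definition setpart1 n : setpart n :=
  exist (fun P => is_true (partition P [set: 'I_n]))
    (preim_partition (fun _ => tt) [set: 'I_n]) (preim_partitionP _ _).

Lemma setpart1E n : (0 < n)%N -> val (setpart1 n) = [set [set: 'I_n]].
Proof.
case: n => // n _; apply/setP => A; rewrite inE; apply/imsetP/eqP => [[i _ ->]|->].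
  by apply/setP => j; rewrite !inE.
by exists ord0 => //; apply/setP => j; rewrite !inE.
Qed.

(* The blocks are numbered from 1, in the order of their enumeration. *)
Definition block_number n (p : setpart n) (i : 'I_n) : nat :=
  (index (pblock (val p) i) (enum (val p))).+1.

Record hilbertSpace (R : realType) := HilbertSpace {
  hilbert_sort :> completeNormedModType R[i];
  hilbert_form : {dot hilbert_sort for (@Num.conj R[i])};
  hilbert_norm : forall x : hilbert_sort, `|x| ^+ 2 = hilbert_form x x }.

Section InnerProduct.
Context {R : realType} {H : hilbertSpace R}.

(* The inner product is linear in its second argument, whereas MathComp's dot
   forms are linear in the first one. *)
Definition inner (x y : H) : R[i] := hilbert_form H y x.

Definition orthonormal_basis (e : nat -> H) : Prop :=
  (forall i j, inner (e i) (e j) = (i == j)%:R) /\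
  topology_structure.closure [set x : H | exists n (c : 'I_n -> R[i]), x = \sum_i c i *: e i]%classic
    = [set: H]%classic.

End InnerProduct.

Definition inversions n (s : 'S_n) : nat :=
  #|[set ij : 'I_n * 'I_n | (ij.1 < ij.2)%N & (s ij.2 < s ij.1)%N]|.

Lemma inversionsE n (s : 'S_n) :
  inversions s = (\sum_(i < n) \sum_(j < n) ((i < j) && (s j < s i)))%N.
Proof.
rewrite pair_big /inversions -sum1dep_card big_mkcond /=.
by apply: eq_bigr => -[i j] _ /=; case: ifP.
Qed.

Lemma inversionsV n (s : 'S_n) : inversions (s^-1)%g = inversions s.
Proof.
rewrite !inversionsE exchange_big (reindex_inj (@perm_inj _ s)) /=.
apply: eq_bigr => i _; rewrite (reindex_inj (@perm_inj _ s)) /=.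
by apply: eq_bigr => j _; rewrite !permK andbC.
Qed.

Lemma inversions_lift n (k : 'I_n.+1) (t : 'S_n) :
  inversions (lift_perm ord0 k t) = (k + inversions t)%N.
Proof.
rewrite !inversionsE big_ord_recl /=; congr addn.
  rewrite big_ord_recl /= add0n lift_perm_id.
  rewrite (reindex_inj (@perm_inj _ (t^-1)%g)) /=.
  rewrite (eq_bigr (fun j : 'I_n => (j < k) : nat)); last first.
    move=> j _; rewrite lift_perm_lift permKV /= /bump; congr nat_of_bool.
    by case: (leqP k j) => kj; lia.
  rewrite -(big_mkord xpredT (fun j => (j < k) : nat)).
  have kn : (k <= n)%N by rewrite -ltnS.
  rewrite (big_cat_nat (leq0n k) kn) /= [X in (_ + X)%N]big_nat_cond.
  rewrite [X in (_ + X)%N]big1 => [|j /andP[/andP[kj _] _]]; last by rewrite ltnNge kj.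
  rewrite addn0 big_nat_cond (eq_bigr (fun=> 1%N)) => [|j /andP[/andP[_ ->]]] //.
  by rewrite -big_nat_cond sum_nat_const_nat subn0 muln1.
apply: eq_bigr => i _; rewrite big_ord_recl /= add0n.
apply: eq_bigr => j _; rewrite !lift_perm_lift /= /bump.
by congr nat_of_bool; case: (leqP k (t j)) => kj; case: (leqP k (t i)) => ki; lia.
Qed.

(* Formal linear combinations of words eta_1 ... eta_n over H, each standing for
   the elementary tensor eta_1 (x) ... (x) eta_n; the empty word is the vacuum.
   The multilinearity relations of the tensor powers lie in the kernel of the
   q-inner product (qinner_multilinear), so that dividing out its null vectors
   gives the same space as for tensors proper. The annihilation operator is the
   adjoint of the creation operator (qinner_annihilation) and both preserve the
   null vectors (creation_null, annihilation_null): vacuum expectations of their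
   products are the same before and after dividing out and completing. *)
Definition fock (R : realType) (H : hilbertSpace R) : lmodType R[i] :=
  malg (seq H) R[i].

Section Fock.
Context {R : realType} {H : hilbertSpace R}.
Implicit Types (xi : H) (u v w : seq H) (x y : fock H).

Definition tensor w : fock H := mkmalgU w 1.

Definition vacuum : fock H := tensor [::].

Definition lin_ext (V : lmodType R[i]) (f : seq H -> V) (x : fock H) : V :=
  \sum_(w <- msupp x) mcoeff w x *: f w.

Definition word_inner u v : R[i] :=
  if size u == size v then \prod_(i < size u) inner (nth 0 u i) (nth 0 v i)
  else 0.

Definition fock_inner x y : R[i] :=
  \sum_(u <- msupp x) \sum_(v <- msupp y)
    (mcoeff u x)^* * mcoeff v y * word_inner u v.

Lemma lin_extw (V : lmodType R[i]) (f : seq H -> V) x (d : {fset seq H}) :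
  fsubset (msupp x) d -> lin_ext f x = \sum_(w <- d) mcoeff w x *: f w.
Proof.
move=> sxd; rewrite /lin_ext [LHS](big_fset_incl _ sxd) // => w _ wx.
by rewrite mcoeff_outdom // scale0r.
Qed.

Lemma lin_ext_linear (V : lmodType R[i]) (f : seq H -> V) : linear (lin_ext f).
Proof.
move=> a x y; pose d := fsetU (msupp x) (msupp y).
rewrite !(@lin_extw _ _ _ d) ?fsubsetUl ?fsubsetUr //.
  rewrite scaler_sumr -big_split /=; apply: eq_bigr => w _.
  by rewrite mcoeffD mcoeffZ scalerDl scalerA.
apply: fsubset_trans (msuppD_le _ _) _; rewrite fsubUset fsubsetUr andbT.
exact: fsubset_trans (msuppZ_le _ _) (fsubsetUl _ _).
Qed.

HB.instance Definition _ (V : lmodType R[i]) (f : seq H -> V) :=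
  GRing.isLinear.Build R[i] (fock H) V _ (lin_ext f) (lin_ext_linear f).

Lemma lin_ext_tensor (V : lmodType R[i]) (f : seq H -> V) w :
  lin_ext f (tensor w) = f w.
Proof.
rewrite (@lin_extw _ _ _ [fset w]%fset) ?msuppU_le // big_seq_fset1.
by rewrite mcoeffUU scale1r.
Qed.

Lemma fock_tensorE x : x = \sum_(w <- msupp x) mcoeff w x *: tensor w.
Proof.
rewrite {1}[x]monalgE; apply: eq_bigr => w _; apply/malgP => v.
by rewrite mcoeffZ !mcoeffU mulr_natr.
Qed.

Lemma fock_innerE x y :
  fock_inner x y = \sum_(u <- msupp x)
    (mcoeff u x)^* * lin_ext (fun v => word_inner u v : R[i]^o) y.
Proof.
apply: eq_bigr => u _; rewrite mulr_sumr; apply: eq_bigr => v _.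
by rewrite mulrA.
Qed.

Lemma fock_inner_scalar x : scalar (fock_inner x).
Proof.
move=> a y z; rewrite !fock_innerE mulr_sumr -big_split /=.
apply: eq_bigr => u _; rewrite linearP mulrDr; congr (_ + _).
by rewrite mulrCA.
Qed.

Lemma fock_inner_tensorl u y :
  fock_inner (tensor u) y = lin_ext (fun v => word_inner u v : R[i]^o) y.
Proof.
rewrite fock_innerE msuppU oner_eq0 big_seq_fset1.
by rewrite mcoeffUU conjC1 mul1r.
Qed.

Lemma fock_inner_tensor u v : fock_inner (tensor u) (tensor v) = word_inner u v.
Proof. by rewrite fock_inner_tensorl lin_ext_tensor. Qed.

Lemma fock_inner_suml x y :
  fock_inner x y = \sum_(u <- msupp x) (mcoeff u x)^* * fock_inner (tensor u) y.
Proof. by rewrite fock_innerE; apply: eq_bigr => u _; rewrite fock_inner_tensorl. Qed.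

Lemma fock_inner_conj x y :
  fock_inner x y = (lin_ext (fun u => (fock_inner (tensor u) y)^* : R[i]^o) x)^*.
Proof.
rewrite fock_inner_suml rmorph_sum; apply: eq_bigr => u _.
by rewrite rmorphM /= conjCK.
Qed.

Lemma fock_inner_linearl a x y z :
  fock_inner (a *: x + y) z = a^* * fock_inner x z + fock_inner y z.
Proof. by rewrite !fock_inner_conj linearP rmorphD rmorphM. Qed.

Variable q : R.

Definition qsymm_word w : fock H :=
  \sum_(s : 'S_(size w)) q%:C%C ^+ inversions s *:
    tensor [seq nth 0 w ((s^-1)%g i) | i : 'I_(size w)].

Definition qsymm : fock H -> fock H := lin_ext qsymm_word.

Definition qinner x y : R[i] := fock_inner x (qsymm y).

Definition creation xi : fock H -> fock H :=
  lin_ext (fun w => tensor (xi :: w)).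

Definition annihilation xi : fock H -> fock H :=
  lin_ext (fun w => \sum_(k < size w)
    (q%:C%C ^+ k * inner xi (nth 0 w k)) *: tensor (take k w ++ drop k.+1 w)).

Definition rho (X : fock H -> fock H) : R[i] := qinner vacuum (X vacuum).

End Fock.

Section FockTheory.
Context {R : realType} {H : hilbertSpace R}.
Variable q : R.
Implicit Types (xi : H) (u v w : seq H) (x y : fock H).

Lemma qinner_scalar x : scalar (qinner q x).
Proof.
by move=> a y z; rewrite /qinner /qsymm linearP fock_inner_scalar.
Qed.

HB.instance Definition _ x :=
  GRing.isLinear.Build R[i] (fock H) R[i] *%R (qinner q x) (qinner_scalar x).

Lemma qinner_linearl a x y z :
  qinner q (a *: x + y) z = a^* * qinner q x z + qinner q y z.
Proof. exact: fock_inner_linearl. Qed.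

Lemma qinner0l z : qinner q (0 : fock H) z = 0.
Proof. by rewrite /qinner fock_innerE msupp0 big_seq_fset0. Qed.

Lemma qinnerDl x y z : qinner q (x + y) z = qinner q x z + qinner q y z.
Proof. by have := qinner_linearl 1 x y z; rewrite scale1r conjC1 mul1r. Qed.

Lemma qinnerZl a x z : qinner q (a *: x) z = a^* * qinner q x z.
Proof. by have := qinner_linearl a x 0 z; rewrite addr0 qinner0l addr0. Qed.

Lemma qinner_suml (I : Type) (r : seq I) (P : pred I) (F : I -> fock H) z :
  qinner q (\sum_(i <- r | P i) F i) z = \sum_(i <- r | P i) qinner q (F i) z.
Proof.
apply: (big_morph (fun x => qinner q x z)); last exact: qinner0l.
by move=> x y; exact: qinnerDl.
Qed.

Lemma qinner_tensor n u v : size u = n -> size v = n ->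
  qinner q (tensor u) (tensor v) =
  \sum_(s : 'S_n) q%:C%C ^+ inversions s *
    \prod_(i < n) inner (nth 0 u i) (nth 0 v (s i)).
Proof.
move=> + vn; case: _ / vn => {n} uv; rewrite /qinner /qsymm lin_ext_tensor.
rewrite fock_inner_tensorl linear_sum (reindex_inj invg_inj) /=.
apply: eq_bigr => s _; rewrite linearZ /= lin_ext_tensor inversionsV invgK.
rewrite /word_inner size_map size_enum_ord uv eqxx; congr (_ * _).
apply: eq_bigr => i _; congr inner.
by rewrite (nth_map i) ?size_enum_ord // nth_ord_enum.
Qed.

Lemma qinner_tensor0 u v : size u != size v -> qinner q (tensor u) (tensor v) = 0.
Proof.
move=> uv; rewrite /qinner /qsymm lin_ext_tensor fock_inner_tensorl linear_sum.
apply: big1 => s _; rewrite linearZ /= lin_ext_tensor /word_inner.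
by rewrite size_map size_enum_ord (negbTE uv) scaler0.
Qed.

Lemma innerC (xi eta : H) : inner xi eta = (inner eta xi)^*.
Proof. by rewrite /inner hermC expr0 mul1r. Qed.

Lemma conj_real : (q%:C%C)^* = q%:C%C :> R[i].
Proof. by apply/CrealP/complex_realP; exists q. Qed.

Lemma qinnerC_tensor u v :
  qinner q (tensor u) (tensor v) = (qinner q (tensor v) (tensor u))^*.
Proof.
have [uv|uv] := eqVneq (size u) (size v); last first.
  rewrite qinner_tensor0 // qinner_tensor0; first by rewrite conjC0.
  by rewrite eq_sym.
rewrite (@qinner_tensor (size v)) //.
rewrite (@qinner_tensor (size v) v u) //.
rewrite rmorph_sum (reindex_inj invg_inj) /=; apply: eq_bigr => s _.
rewrite inversionsV rmorphM rmorphXn /= conj_real rmorph_prod; congr (_ * _).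
rewrite (reindex_inj (@perm_inj _ s)) /=; apply: eq_bigr => i _.
by rewrite permK innerC.
Qed.

Lemma qinner_suml_tensor x y :
  qinner q x y = \sum_(u <- msupp x) (mcoeff u x)^* * qinner q (tensor u) y.
Proof.
by rewrite {1}[x]fock_tensorE qinner_suml; apply: eq_bigr => u _; rewrite qinnerZl.
Qed.

Lemma qinner_sumr_tensor x y :
  qinner q x y = \sum_(v <- msupp y) mcoeff v y * qinner q x (tensor v).
Proof.
by rewrite {1}[y]fock_tensorE linear_sum; apply: eq_bigr => u _; rewrite linearZ.
Qed.

Lemma qinnerC x y : qinner q x y = (qinner q y x)^*.
Proof.
rewrite qinner_suml_tensor [in RHS]qinner_sumr_tensor rmorph_sum.
apply: eq_bigr => u _; rewrite rmorphM /=; congr (_ * _).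
rewrite [in RHS]qinner_suml_tensor [LHS]qinner_sumr_tensor rmorph_sum.
by apply: eq_bigr => v _; rewrite rmorphM /= conjCK -qinnerC_tensor.
Qed.

Lemma qinner_multilinear a (xi eta : H) u v x :
  qinner q x (tensor (u ++ (a *: xi + eta) :: v)) =
  a * qinner q x (tensor (u ++ xi :: v)) + qinner q x (tensor (u ++ eta :: v)).
Proof.
rewrite !(qinner_suml_tensor x) mulr_sumr -big_split /=; apply: eq_bigr => w _.
rewrite mulrCA -mulrDr; congr (_ * _).
pose n := (size u + (size v).+1)%N.
have sz (z : H) : size (u ++ z :: v) = n by rewrite size_cat.
have [wn|wn] := eqVneq (size w) n; last first.
  by rewrite !qinner_tensor0 ?sz // mulr0 addr0.
rewrite !(qinner_tensor wn (sz _)) mulr_sumr -big_split /=.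
apply: eq_bigr => s _; rewrite mulrCA -mulrDr; congr (_ * _).
have un : (size u < n)%N by rewrite /n; lia.
pose k := (s^-1)%g (Ordinal un).
have E z : \prod_(i < n) inner (nth 0 w i) (nth 0 (u ++ z :: v) (s i)) =
    inner (nth 0 w k) z *
    \prod_(i < n | i != k) inner (nth 0 w i) (nth 0 (u ++ 0 :: v) (s i)).
  rewrite (bigD1 k) //= permKV /= nth_cat ltnn subnn /=; congr (_ * _).
  apply: eq_bigr => i ik; congr inner; rewrite !nth_cat.
  case: ltnP => // usi; case siu: (s i - size u)%N => [|//].
  case/eqP: ik; apply: (canRL (permK s)); apply/val_inj => /=; lia.
rewrite !E mulrA -mulrDl; congr (_ * _).
by rewrite /inner linearPl.
Qed.

Lemma qinnerZr a x y : qinner q x (a *: y) = a * qinner q x y.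
Proof. exact: linearZ. Qed.

Lemma qinner_sumr x (I : Type) (r : seq I) (P : pred I) (F : I -> fock H) :
  qinner q x (\sum_(i <- r | P i) F i) = \sum_(i <- r | P i) qinner q x (F i).
Proof. exact: linear_sum. Qed.

Lemma lin_ext_sum (V : lmodType R[i]) (f : seq H -> V) x :
  lin_ext f x = \sum_(w <- msupp x) mcoeff w x *: f w.
Proof. by []. Qed.

Lemma qinner_annihilation_tensor xi u v :
  qinner q (annihilation q xi (tensor u)) (tensor v) =
  qinner q (tensor u) (tensor (xi :: v)).
Proof.
rewrite /annihilation lin_ext_tensor.
have [un|un] := eqVneq (size u) (size v).+1; last first.
  rewrite [RHS]qinner_tensor0 //= qinner_suml big1 // => k _.
  rewrite qinnerZl qinner_tensor0 ?mulr0 // size_cat size_take size_drop ltn_ord.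
  by have := ltn_ord k; lia.
rewrite qinner_suml un (@qinner_tensor (size v).+1) //.
rewrite (partition_big (fun s : 'S_(size v).+1 => (s^-1)%g ord0) predT) //=.
apply: eq_bigr => k _.
have sz : size (take k u ++ drop k.+1 u) = size v.
  by rewrite size_cat size_take size_drop un ltn_ord; have := ltn_ord k; lia.
rewrite qinnerZl (@qinner_tensor (size v)) // mulr_sumr.
rewrite (reindex_inj invg_inj) [RHS](reindex_inj invg_inj) /=.
under [RHS]eq_bigl => s do rewrite invgK.
rewrite [RHS](reindex (lift_perm ord0 k)); last first.
  pose ulsf i (s : 'S_(size v).+1) j := odflt j (unlift (s i) (s (lift i j))).
  have ulsfK i (s : 'S_(size v).+1) j : lift (s i) (ulsf i s j) = s (lift i j).
    rewrite /ulsf; have := neq_lift i j.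
    by rewrite -(can_eq (permK s)) => /unlift_some[] ? ? ->.
  have inj_ulsf s : injective (ulsf ord0 s).
    apply: can_inj (ulsf (s ord0) s^-1%g) _ => j.
    by rewrite {1}/ulsf ulsfK !permK liftK.
  exists (fun s => perm (inj_ulsf s)) => [s _ | s].
    by apply/permP => j; rewrite permE /ulsf lift_perm_lift lift_perm_id liftK.
  move=> /(s _ =P _) si0; apply/permP => j.
  case: (unliftP ord0 j) => [j'|] ->; rewrite ?lift_perm_id //.
  by rewrite lift_perm_lift -si0 permE ulsfK.
apply: eq_big => [s|s _]; first by rewrite lift_perm_id eqxx.
rewrite !inversionsV inversions_lift exprD.
rewrite rmorphM rmorphXn /= conj_real -innerC -!mulrA; congr (_ * _).
rewrite mulrCA; congr (_ * _).
rewrite (bigD1_ord k) //= lift_permV lift_perm_id /=; congr (_ * _).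
apply: eq_bigr => i _.
rewrite lift_perm_lift /=; congr inner.
rewrite nth_cat size_take un ltn_ord /= /bump; case: ltnP => ki.
  by rewrite nth_take // leqNgt ki.
by rewrite nth_drop; congr nth; lia.
Qed.

Lemma qinner_annihilation xi x y :
  qinner q (annihilation q xi x) y = qinner q x (creation xi y).
Proof.
rewrite /annihilation lin_ext_sum qinner_suml [RHS]qinner_suml_tensor.
apply: eq_bigr => u _; rewrite qinnerZl.
rewrite /creation lin_ext_sum qinner_sumr [in LHS]qinner_sumr_tensor.
rewrite !mulr_sumr; apply: eq_bigr => v _; rewrite qinnerZr.
by rewrite -qinner_annihilation_tensor /annihilation lin_ext_tensor.
Qed.

Lemma creation_null xi x : (forall y, qinner q y x = 0) ->
  forall y, qinner q y (creation xi x) = 0.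
Proof. by move=> x0 y; rewrite -qinner_annihilation. Qed.

Lemma annihilation_null xi x : (forall y, qinner q y x = 0) ->
  forall y, qinner q y (annihilation q xi x) = 0.
Proof. by move=> x0 y; rewrite qinnerC qinner_annihilation -qinnerC. Qed.

End FockTheory.

(* Elements of the *-algebra generated by an operator and its adjoint, written
   as *-polynomials in that operator. *)
Inductive star_poly (K : Type) :=
  | Gen
  | GenAdj
  | Scal of K
  | Add of star_poly K & star_poly K
  | Mul of star_poly K & star_poly K.
Arguments Gen {K}.
Arguments GenAdj {K}.

Section Cumulants.
Context {R : realType} {H : hilbertSpace R}.
Variables (q : R) (e : nat -> H).
Implicit Type X : star_poly R[i].

(* [copy X k] is the operator X^(k); X itself is the operator [copy X 0]. *)
Fixpoint copy X (k : nat) : fock H -> fock H :=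
  match X with
  | Gen => creation (e k)
  | GenAdj => annihilation q (e k)
  | Scal c => fun x => c *: x
  | Add Y Z => fun x => copy Y k x + copy Z k x
  | Mul Y Z => copy Y k \o copy Z k
  end.

Definition rho_part n (p : setpart n) (X : 'I_n -> star_poly R[i]) : R[i] :=
  rho q (\big[(fun f g => f \o g)/id]_(i < n) copy (X i) (block_number p i)).

Definition cumulant_part n (p : setpart n) (X : 'I_n -> star_poly R[i]) : R[i] :=
  \sum_(s : setpart n | (s <= p)%O) rho_part s X * (moebius s p)%:~R.

Definition cumulant n (X : 'I_n -> star_poly R[i]) : R[i] :=
  cumulant_part (setpart1 n) X.

End Cumulants.

Definition star_pow (K : nzRingType) (X : star_poly K) (k : nat) : star_poly K :=
  iter k (Mul X) (Scal 1).

Inductive exponent := Star | Pow of nat.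

Definition Lpow (K : nzRingType) (eps : exponent) : star_poly K :=
  match eps with Star => GenAdj | Pow k => star_pow Gen k end.

Definition weight (eps : exponent) : int :=
  match eps with Star => -1 | Pow k => k%:Z end.

Definition lattice_word n (eps : 'I_n -> exponent) : Prop :=
  let y (j : nat) := \sum_(i < n | (j <= i)%N) weight (eps i) in
  (forall j : nat, (j <= n)%N -> 0 <= y j) /\ y 0%N = 0.

Definition qnum (K : nzRingType) (q : K) (m : nat) : K := \sum_(i < m) q ^+ i.

Definition qfact (K : nzRingType) (q : K) (m : nat) : K :=
  \prod_(i < m) qnum q i.+1.

(* Main.v *)
From HB Require Import structures.
Require Import Defs.
From mathcomp Require Import all_boot all_order all_algebra complex.
From mathcomp Require Import reals normedtype.
From mathcomp Require Import all_fingroup zify.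
From mathcomp Require Import -(notations) monalg.

Set Implicit Arguments.
Unset Strict Implicit.
Unset Printing Implicit Defensive.

Import Order.TTheory GRing.Theory Num.Theory.
Local Open Scope ring_scope.

(** Expanding every annihilation operator writes [rho_p] as a sum over matchings
    of weights that do not depend on [p]: a matching sends each [L^*] to a later
    power of [L], whose particle it annihilates, and it contributes to [rho_p]
    exactly when matched positions lie in the same block of [p], that is, when
    the partition whose blocks consist of one power and the stars matched to it
    refines [p]. By Moebius inversion the cumulant is the sum over the matchings
    whose partition has a single block. Such a matching leaves room for only one
    power of [L], in last position and preceded by stars; in that case every
    matching has this property and the cumulant is the full expectation. *)

(** * Moebius inversion *)

(* [moebius_sum] says that the Moebius matrix is a left inverse of the zeta
   matrix; a left inverse of a square matrix is also a right inverse. *)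
Lemma moebius_sumr (disp : Order.disp_t) (T : finPOrderType disp) (x y : T) :
  \sum_(z | (x <= z <= y)%O) moebius z y = (x == y)%:R.
Proof.
pose M := \matrix_(i < #|T|, j < #|T|)
  if (enum_val i <= enum_val j)%O then moebius (enum_val i : T) (enum_val j : T)
  else 0.
pose Z : 'M[int]_#|T| := \matrix_(i < #|T|, j < #|T|) ((enum_val i : T) <= (enum_val j : T))%O%:R%R.
have MZ : M *m Z = 1%:M.
  apply/matrixP => i j; rewrite !mxE.
  transitivity (\sum_(z | (enum_val i <= z <= enum_val j)%O) moebius (enum_val i : T) z).
    rewrite [RHS]big_mkcond (reindex _ (onW_bij _ (@enum_val_bij T))) /=.
    apply: eq_bigr => k _; rewrite !mxE.
    by case: (_ <= _)%O; case: (_ <= _)%O; rewrite ?mulr1 ?mulr0 ?mul0r.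
  have [->|ij] := eqVneq i j.
    rewrite (big_pred1 (enum_val j)) ?moebiusxx // => z.
    by rewrite /= eq_sym eq_le.
  have [le_ij|nle_ij] := boolP (enum_val i <= enum_val j :> T)%O.
    apply: moebius_sum; rewrite lt_neqAle le_ij andbT.
    by apply: contraNneq ij => /enum_val_inj->.
  rewrite big_pred0 // => z; apply/negbTE; apply: contra nle_ij => /andP[].
  exact: le_trans.
have := mulmx1C MZ => /matrixP/(_ (enum_rank x) (enum_rank y)).
rewrite !mxE (inj_eq enum_rank_inj) => <-.
rewrite big_mkcond (reindex _ (onW_bij _ (@enum_val_bij T))) /=.
apply: eq_bigr => k _; rewrite !mxE !enum_rankK.
by case: (_ <= _)%O; case: (_ <= _)%O; rewrite ?mul1r ?mulr0 ?mul0r.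
Qed.

(** * Set partitions *)

Lemma refines_pblock n (s p : setpart n) (i j : 'I_n) :
  (s <= p)%O -> pblock (val s) i = pblock (val s) j ->
  pblock (val p) i = pblock (val p) j.
Proof.
have /and3P[/eqP cs ts _] := valP s; have /and3P[_ tp _] := valP p.
have mem k : k \in cover (val s) by rewrite cs inE.
move=> /refinesP sp ij; have [B Bp /subsetP sB] := sp _ (pblock_mem (mem i)).
have iB : i \in B by apply: sB; rewrite mem_pblock.
have jB : j \in B by apply: sB; rewrite ij mem_pblock.
by rewrite (def_pblock tp Bp iB) (def_pblock tp Bp jB).
Qed.

Lemma block_number_inj n (p : setpart n) (i j : 'I_n) :
  (block_number p i == block_number p j) = (pblock (val p) i == pblock (val p) j).
Proof.
have /and3P[/eqP cp _ _] := valP p.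
have mem k : pblock (val p) k \in enum (val p).
  by rewrite mem_enum pblock_mem // cp inE.
apply/eqP/eqP => [[]|]; last by rewrite /block_number => ->.
by move/(congr1 (nth set0 (enum (val p)))); rewrite !nth_index.
Qed.

Definition kernel_part n (T : finType) (f : 'I_n -> T) : setpart n :=
  exist (fun P => is_true (partition P [set: 'I_n]))
    (preim_partition f [set: 'I_n]) (preim_partitionP _ _).

Lemma pblock_kernel_part n (T : finType) (f : 'I_n -> T) (i j : 'I_n) :
  (j \in pblock (val (kernel_part f)) i) = (f i == f j).
Proof.
rewrite /= pblock_equivalence_partition ?inE //.
by split=> // /eqP->.
Qed.

(** Idempotence makes [f i] a representative of the block of [i], so a partition contains each block
    as soon as it joins every [i] to [f i]. *)
Lemma kernel_part_le n (f : 'I_n -> 'I_n) (p : setpart n) :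
  (forall i, f (f i) = f i) ->
  (kernel_part f <= p)%O = [forall i, block_number p i == block_number p (f i)].
Proof.
move=> ff; have /and3P[/eqP ck tk k0] := valP (kernel_part f).
have /and3P[/eqP cp tp _] := valP p.
apply/idP/forallP => [kp i|pf].
  rewrite block_number_inj; apply/eqP/(refines_pblock kp)/same_pblock => //.
  by rewrite pblock_kernel_part ff.
apply/refinesP => A Ak; have [i iA] : exists i, i \in A.
  by apply/set0Pn; apply: contraNneq k0 => <-.
exists (pblock (val p) i); first by rewrite pblock_mem // cp inE.
apply/subsetP => j; rewrite -(def_pblock tk Ak iA) pblock_kernel_part => /eqP fij.
move: (pf i) (pf j); rewrite !block_number_inj fij => /eqP-> /eqP<-.
by rewrite mem_pblock cp inE.
Qed.

Lemma kernel_part_eq1 n (T : finType) (f : 'I_n -> T) :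
  reflect (forall i j, f i = f j) (kernel_part f == setpart1 n).
Proof.
apply: (iffP eqP) => [f1 i j|fE].
  apply/eqP; rewrite -pblock_kernel_part f1.
  (* [setpart1 n] is by definition the kernel partition of a constant map. *)
  by rewrite [setpart1 n](_ : _ = kernel_part (fun=> tt)) // pblock_kernel_part.
apply: val_inj; apply: eq_imset => i /=.
by apply/setP => j; rewrite !inE (fE i j) eqxx.
Qed.

Lemma setpart1_max n (p : setpart n) : (p <= setpart1 n)%O.
Proof.
have /and3P[_ _ p0] := valP p; apply/refinesP => A Ap.
have [i iA] : exists i, i \in A by apply/set0Pn; apply: contraNneq p0 => <-.
rewrite setpart1E ?(leq_ltn_trans _ (ltn_ord i)) //.
by exists [set: 'I_n]; rewrite ?inE ?subsetT.
Qed.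

Lemma block_number_setpart1 n (i : 'I_n) : block_number (setpart1 n) i = 1%N.
Proof.
have /and3P[/eqP cp _ _] := valP (setpart1 n).
have : pblock (val (setpart1 n)) i \in val (setpart1 n).
  by rewrite pblock_mem // cp inE.
rewrite /block_number setpart1E ?(leq_ltn_trans _ (ltn_ord i)) //.
by rewrite inE enum_set1 => /eqP->; rewrite /= eqxx.
Qed.

(** Turns an operator product applied to the vacuum into a fold, so that expectations can be
    expanded by induction on the list of positions. *)
Lemma big_comp_foldr (T : Type) (I : finType) (F : I -> T -> T) (x : T) :
  (\big[(fun f g => f \o g)/id]_(i : I) F i) x = foldr F x (enum I).
Proof.
rewrite [index_enum I]unlock -enumT.
by elim: (enum I) => [|i r IHr]; rewrite ?big_nil ?big_cons //= IHr.
Qed.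

(** * Vacuum expectations *)

Definition is_pow (x : exponent) : bool := if x is Pow _ then true else false.

Section Fock.
Context (R : realType) (H : hilbertSpace R) (q : R) (e : nat -> H).
Context (e_orth : forall i j, inner (e i) (e j) = (i == j)%:R).

Lemma qinner_vacuum_tensor (w : seq H) :
  qinner q vacuum (tensor w) = (nilp w)%:R.
Proof.
case: w => [|x w]; last by rewrite qinner_tensor0.
rewrite (@qinner_tensor _ _ _ 0) // (bigD1 (1 : 'S_0)%g) //= big_ord0.
rewrite big1 ?addr0 => [|s /eqP[]]; last by apply/permP => -[].
suff -> : inversions (1 : 'S_0)%g = 0%N by rewrite expr0 mulr1.
by apply: eq_card0 => -[[]].
Qed.

Lemma copy_pow (k c : nat) (w : seq H) :
  copy q e (star_pow Gen k) c (tensor w) = tensor (nseq k (e c) ++ w).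
Proof.
elim: k => [|k IHk] /=; first by rewrite scale1r.
by rewrite /star_pow /= in IHk *; rewrite IHk /creation lin_ext_tensor.
Qed.

Lemma copy_linear (X : star_poly R[i]) (k : nat) : linear (copy q e X k).
Proof.
elim: X => [||c|X IHX Y IHY|X IHX Y IHY] a x y /=.
- by rewrite /creation linearP.
- by rewrite /annihilation linearP.
- by rewrite scalerDr !scalerA mulrC.
- by rewrite IHX IHY scalerDr addrACA.
- by rewrite IHY IHX.
Qed.

HB.instance Definition _ X k :=
  GRing.isLinear.Build R[i] (fock H) (fock H) _ (copy q e X k) (copy_linear X k).

(** Orthonormality reduces the inner products to equality tests on colours, so the words of origins
    and the powers of [q] do not depend on the colouring. *)
Lemma annihilation_colored (I : Type) (c : I -> nat) (i0 : I) (k : nat) (w : seq I) :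
  annihilation q (e k) (tensor [seq e (c i) | i <- w]) =
  \sum_(j <- iota 0 (size w)) (q%:C%C ^+ j * (k == c (nth i0 w j))%:R) *:
    tensor [seq e (c i) | i <- take j w ++ drop j.+1 w].
Proof.
rewrite /annihilation lin_ext_tensor size_map -[X in iota 0 X]subn0 -/(index_iota 0 _).
rewrite big_mkord; apply: eq_bigr => j _.
rewrite (nth_map i0); last exact: ltn_ord.
by rewrite e_orth map_cat map_take map_drop.
Qed.

(** Deleting any of [m.+1] equal letters leaves the same word, so one annihilation contributes the
    factor [qnum q m.+1]. *)
Lemma copy_adj_pow (k m : nat) :
  copy q e (star_pow GenAdj m) k (tensor (nseq m (e k))) =
  qfact q%:C%C m *: vacuum.
Proof.
elim: m => [|m IHm]; first by rewrite /qfact big_ord0 /=.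
(* [star_pow] exposes the outermost factor, but the recursion needs the innermost one; all factors
   are the same operator. *)
transitivity (copy q e (star_pow GenAdj m) k
                (annihilation q (e k) (tensor (nseq m.+1 (e k))))).
  rewrite -[annihilation q (e k)]/(copy q e GenAdj k); move: (tensor _) => x.
  by elim: (m) x => [|p IHp] x /=; [rewrite !scale1r | rewrite -IHp].
suff -> : annihilation q (e k) (tensor (nseq m.+1 (e k))) =
    qnum q%:C%C m.+1 *: tensor (nseq m (e k)).
  have -> : qfact q%:C%C m.+1 = qnum q%:C%C m.+1 * qfact q%:C%C m :> R[i].
    by rewrite /qfact big_ord_recr mulrC.
  by rewrite linearZ /= IHm scalerA.
rewrite /annihilation lin_ext_tensor size_nseq scaler_suml.
apply: eq_bigr => j _; rewrite nth_nseq ltn_ord e_orth eqxx mulr1; congr (_ *: tensor _).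
rewrite take_nseq ?drop_nseq -?nseqD; last exact: ltnW.
by congr nseq; have := ltn_ord j; lia.
Qed.

(* Expanding all annihilations: each term [(a, f, w)] of [S] is a choice, for
   every star at position [i], of the position [f i] whose power creates the
   particle it annihilates; [w] lists the origins of the surviving particles.
   The colouring [c] enters only through the requirement that matched
   positions have the same colour. *)
Lemma matching_expansion n (eps : 'I_n -> exponent) (r : seq 'I_n) :
  sorted (fun i j : 'I_n => (i < j)%N) r ->
  exists S : seq (R[i] * {ffun 'I_n -> 'I_n} * seq 'I_n),
    (forall c : 'I_n -> nat,
      foldr (fun i => copy q e (Lpow R[i] (eps i)) (c i)) vacuum r =
      \sum_(t <- S) (t.1.1 * [forall i, c i == c (t.1.2 i)]%:R) *:
         tensor [seq e (c i) | i <- t.2]) /\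
    (forall t, t \in S ->
      [/\ forall i, is_pow (eps i) || (i \notin r) -> t.1.2 i = i,
          forall i, i \in r -> ~~ is_pow (eps i) ->
            is_pow (eps (t.1.2 i)) && (i < t.1.2 i)%N
        & forall i, i \in t.2 -> is_pow (eps i) && (i \in r)]).
Proof.
elim: r => [|i r IHr] /= sr.
  exists [:: (1, [ffun i => i], [::])]; split=> [c|t].
    rewrite big_cons big_nil addr0 /= mul1r.
    by case: forallP => [_|[] k]; rewrite ?scale1r // ffunE.
  by rewrite inE => /eqP -> /=; split=> // j _; rewrite ffunE.
have trans : transitive (fun i j : 'I_n => (i < j)%N).
  by move=> y x z; exact: ltn_trans.
have /IHr[S [SE SP]] := path_sorted sr.
have ir k : k \in r -> (i < k)%N.
  by move: sr; rewrite path_sortedE // => /andP[/allP/(_ k)].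
have iNr : i \notin r by apply: contraTN isT => /ir; rewrite ltnn.
case epsi: (eps i) => [|m].
(* A star at [i] removes the surviving particle at index [j], at the cost of [q ^+ j], and is
   matched to its origin. *)
- pose g (t : R[i] * {ffun 'I_n -> 'I_n} * seq 'I_n) (j : nat) :=
    (t.1.1 * q%:C%C ^+ j, [ffun k => if k == i then nth i t.2 j else t.1.2 k],
     take j t.2 ++ drop j.+1 t.2).
  exists [seq g t j | t <- S, j <- iota 0 (size t.2)]; split=> [c|t'].
    rewrite SE -[copy _ _ _ _]/(copy q e GenAdj (c i)) linear_sum big_allpairs_dep.
    rewrite big_seq [RHS]big_seq; apply: eq_bigr => t /SP[tid _ _].
    rewrite linearZ /= (annihilation_colored _ i) scaler_sumr.
    apply: eq_bigr => j _; rewrite scalerA /=; congr (_ *: _).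
    rewrite mulrACA -natrM mulnb; congr (_ * _%:R); congr nat_of_bool.
    (* The old matching fixes [i], so its condition at [i] is vacuous; the new one there is the
       colour test. *)
    apply/andP/forallP => [[/forallP tc ij] k|tc].
      by rewrite ffunE; case: (k =P i) => [->|].
    split; last by have := tc i; rewrite ffunE eqxx.
    apply/forallP => k; have := tc k; rewrite ffunE; case: (k =P i) => // -> _.
    by rewrite tid // iNr orbT.
  move=> /allpairsPdep[t [j [/SP[tid tst tw]]]].
  rewrite mem_iota /= add0n => jw -> /=; split=> k.
  + rewrite ffunE; case: eqP => [->|ki]; first by rewrite epsi inE eqxx.
    by rewrite inE negb_or => /orP[kp|/andP[_ kr]]; apply: tid; rewrite ?kp ?kr ?orbT.
  + rewrite ffunE inE; case: eqP => [->|ki] /= kr; last exact: tst.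
    by have /tw /andP[-> /ir ->] := mem_nth i jw.
  + move=> kw; have /tw/andP[-> kr] : k \in t.2.
      by move: kw; rewrite mem_cat => /orP[/mem_take|/mem_drop].
    by rewrite inE kr orbT.
(* A power creates [m] particles of origin [i]; weight and matching are unchanged. *)
- pose g (t : R[i] * {ffun 'I_n -> 'I_n} * seq 'I_n) := (t.1, nseq m i ++ t.2).
  exists (map g S); split=> [c|t'].
    rewrite SE linear_sum big_map; apply: eq_bigr => t _.
    by rewrite linearZ /= copy_pow map_cat map_nseq.
  move=> /mapP[t /SP[tid tst tw] -> /=]; split=> k.
  + rewrite inE negb_or => /orP[kp|/andP[_ kr]]; apply: tid; rewrite ?kp ?kr ?orbT //.
  + rewrite inE; case: eqP => [->|ki] /=; [by rewrite epsi|exact: tst].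
  + rewrite mem_cat mem_nseq inE => /orP[/andP[_ /eqP->]|/tw/andP[-> ->]].
      by rewrite epsi eqxx.
    by rewrite orbT.
Qed.

(* Moebius inversion keeps exactly the matchings [f] whose kernel has a single
   block. *)
Lemma cumulant_expansion n (eps : 'I_n -> exponent) :
  exists S : seq (R[i] * {ffun 'I_n -> 'I_n}),
    [/\ cumulant q e (fun i => Lpow R[i] (eps i)) =
          \sum_(t <- S) t.1 * (kernel_part t.2 == setpart1 n)%:R,
        rho_part q e (setpart1 n) (fun i => Lpow R[i] (eps i)) = \sum_(t <- S) t.1
      & forall t, t \in S -> forall i,
          if is_pow (eps i) then t.2 i = i
          else is_pow (eps (t.2 i)) && (i < t.2 i)%N].
Proof.
have sr : sorted (fun i j : 'I_n => (i < j)%N) (enum 'I_n).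
  have := iota_ltn_sorted 0 n; rewrite -val_enum_ord sorted_map.
  exact.
have [S [SE SP]] := matching_expansion eps sr.
(* Only terms without surviving particles pair nontrivially with the vacuum. *)
pose S' := [seq t.1 | t <- S & nilp t.2].
have rhoE p : rho_part q e p (fun i => Lpow R[i] (eps i)) =
    \sum_(t <- S') t.1 * [forall i, block_number p i == block_number p (t.2 i)]%:R.
  rewrite /rho_part /rho big_comp_foldr SE linear_sum /S' big_map big_filter.
  rewrite [RHS]big_mkcond; apply: eq_bigr => t _.
  rewrite linearZ /= qinner_vacuum_tensor /nilp size_map.
  by case: ifP; rewrite ?mulr1 ?mulr0.
have S'P t : t \in S' -> forall i,
    if is_pow (eps i) then t.2 i = i else is_pow (eps (t.2 i)) && (i < t.2 i)%N.
  case/mapP=> t'; rewrite mem_filter => /andP[_ /SP[tid tst _]] -> i.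
  case: ifP => ip; first by rewrite tid ?ip.
  by apply: tst; rewrite ?mem_enum ?ip.
exists S'; split=> //; last first.
  rewrite rhoE; apply: eq_bigr => t _.
  case: forallP => [_|[] i]; first by rewrite mulr1.
  by rewrite !block_number_setpart1.
rewrite /cumulant /cumulant_part.
under eq_bigr do rewrite rhoE mulr_suml.
rewrite exchange_big /= big_seq [RHS]big_seq; apply: eq_bigr => t /S'P tP.
have tt i : t.2 (t.2 i) = t.2 i.
  by have := tP (t.2 i); have := tP i; case: ifP => [_ ti|_ /andP[-> _]] //; rewrite !ti.
(* The indicator becomes the sum of the Moebius values over all partitions above the kernel. *)
rewrite [X in _ = _ * X]pmulrn -natz -moebius_sumr.
rewrite rmorph_sum mulr_sumr [LHS]big_mkcond [RHS]big_mkcond /=.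
apply: eq_bigr => p _; rewrite setpart1_max andbT -kernel_part_le //.
by case: ifP; rewrite ?mulr1 ?mulr0 ?mul0r.
Qed.

End Fock.

Theorem mainTheorem8 (R : realType) (q : R) (hq : -1 <= q <= 1)
    (H : hilbertSpace R) (e : nat -> H) (he : orthonormal_basis e)
    (n : nat) (hn : (0 < n)%N) (eps : 'I_n -> exponent)
    (heps : lattice_word eps) :
  let L : star_poly R[i] := Gen in
  let Lstar : star_poly R[i] := GenAdj in
  let extremal :=
    (forall i : 'I_n, (i < n.-1)%N -> eps i = Star) /\
    (forall i : 'I_n, nat_of_ord i = n.-1 -> eps i = Pow n.-1) in
  (~ extremal -> cumulant q e (fun i => Lpow R[i] (eps i)) = 0) /\
  (extremal ->
    cumulant q e (fun i => Lpow R[i] (eps i)) =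
      rho q (copy q e (Mul (star_pow Lstar n.-1) (star_pow L n.-1)) 0) /\
    rho q (copy q e (Mul (star_pow Lstar n.-1) (star_pow L n.-1)) 0) =
      qfact (q%:C)%C n.-1).
Proof.
have [e_orth _] := he; have [_ eps0] := heps.
case: n hn eps heps eps0 => // m _ eps heps eps0 L Lstar extremal.
(* Any colour is allowed: the statement uses colour 0, while the one-block partition numbers its
   block 1. *)
have vacE k : rho q (copy q e (Mul (star_pow Lstar m) (star_pow L m)) k) =
    qfact q%:C%C m.
  rewrite /rho /= copy_pow // cats0 copy_adj_pow // qinnerZr.
  by rewrite qinner_vacuum_tensor mulr1.
have [S [cumE rhoE SP]] := cumulant_expansion q e_orth eps.
split=> [next|[eps_star eps_pow]]; last first.
  split; rewrite ?vacE // cumE.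
  transitivity (\sum_(t <- S) t.1).
    rewrite big_seq [RHS]big_seq; apply: eq_bigr => t /SP tP.
    (* The last position carries the only power, so every star is matched to it. *)
    suff const i : t.2 i = ord_max.
      by case: kernel_part_eq1 => [_|[] i j]; rewrite ?mulr1 // !const.
    have := tP i; have [im|mi] := ltnP i m.
      rewrite eps_star //= => /andP[+ _]; have [tm|mt _] := ltnP (t.2 i) m.
        by rewrite eps_star.
      by apply/val_inj/eqP; rewrite eqn_leq mt andbT -ltnS ltn_ord.
    have {mi} -> : i = ord_max.
      by apply/val_inj/eqP; rewrite eqn_leq mi andbT -ltnS ltn_ord.
    by rewrite eps_pow.
  rewrite -rhoE -(vacE 1%N) /rho_part /rho; congr (qinner _ _ _).
  rewrite big_comp_foldr.
  rewrite enum_ordSr foldr_rcons foldr_map eps_pow // block_number_setpart1 /=.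
  move: (copy _ _ _ _ _) => x; rewrite -[in RHS](size_enum_ord m).
  elim: (enum 'I_m) => [|j s /= ->]; first by rewrite /= scale1r.
  rewrite eps_star; last exact: (ltn_ord j).
  by rewrite block_number_setpart1.
rewrite cumE big_seq big1 // => t /SP tP; case: kernel_part_eq1 => [tc|]; rewrite ?mulr0 //.
(* A star in last position would have no later power to be matched to. *)
case: next; have pow_max : is_pow (eps ord_max).
  have := tP ord_max; case: ifP => // _ /andP[_].
  by have := ltn_ord (t.2 ord_max); rewrite /=; lia.
have tE i : t.2 i = ord_max.
  by rewrite (tc i ord_max); have := tP ord_max; rewrite pow_max.
(* An earlier power would be fixed by the matching, which is constantly [ord_max]. *)
have star (i : 'I_m.+1) : (i < m)%N -> eps i = Star.
  move=> im; have := tP i; rewrite tE; case: (eps i) => // k /= /(congr1 val) /=; lia.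
split=> // i im; have -> : i = ord_max by apply: val_inj.
(* The total weight is zero, so the last exponent balances the [m] stars. *)
move: eps0; rewrite (eq_bigl xpredT) // big_ord_recr /=.
rewrite (eq_bigr (fun=> -1)) => [|j _]; last by rewrite star //=.
case: (eps ord_max) pow_max => // k _ /=.
by rewrite sumr_const card_ord mulNrn natz => /eqP; rewrite addrC subr_eq0 => /eqP[->].
Qed.
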